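(* The Cantor process $X$ is not an Itô process.
   Context: Let $h:\mathbb{R}\to[0,1]$ be the Cantor function and define $g:[0,1]\to[0,1]$ by $g(y)=\tfrac12(h(y)+y)$. Let $\Phi:\mathbb{R}\to\mathbb{R}$, $\Phi(x)=g(x-[x])+[x]$, where $[x]$ is the floor of $x$; $\Phi$ is a continuous strictly increasing bijection. The Cantor process is the deterministic process $X=(X^x)_{x\in\mathbb{R}}$ given by $X_t^x=\Phi(t+\Phi^{-1}(x))$, $t\ge0$, $x\in\mathbb{R}$ (not depending on $\omega$). It is a Hunt semimartingale, i.e. a quasi-left continuous time-homogeneous Markov process such that $X^x$ is a semimartingale for every starting point $x$. A (one-dimensional) Markov semimartingale $(X,\mathbb{P}^x)_{x\in\mathbb{R}}$ is called an Itô process if its semimartingale characteristics $(B,C,\nu)$ under every $\mathbb{P}^x$ have the form $$B_t(\omega)=\int_0^t\ell(X_s(\omega))\,ds,\qquad C_t(\omega)=\int_0^tQ(X_s(\omega))\,ds,\qquad \nu(\omega;ds,dy)=N(X_s(\omega),dy)\,ds,$$ where $\ell,Q:\mathbb{R}\to\mathbb{R}$ are measurable, $Q\ge 0$, and $N(x,\cdot)$ is a Borel transition kernel on $\mathbb{R}\times\mathcal{B}(\mathbb{R}\setminus\{0\})$. *)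

(* Defs.v *)
From HB Require Import structures.
From mathcomp Require Import all_boot all_order all_algebra.
From mathcomp Require Import all_classical all_reals all_analysis measurable_realfun.
Set Implicit Arguments.
Unset Strict Implicit.
Unset Printing Implicit Defensive.
Import Order.TTheory GRing.Theory Num.Theory.
Import numFieldNormedType.Exports.
Local Open Scope classical_set_scope.
Local Open Scope ring_scope.

(* Conventions.  The time index is a real number and only times t >= 0 are
   ever inspected.  Processes are functions of time and then of the outcome.
   Adaptedness and predictability are required exactly, path properties and
   identities between processes hold almost surely, simultaneously for all
   times.  No right-continuity or completeness of filtrations is assumed; the
   usual conditions are a particular case.  The definitions of semimartingales
   and of their characteristics follow Jacod and Shiryaev. *)

Section cantor_function.
Context {R : realType}.

(* Iterative construction of the Cantor function, started from the identity of
   [0, 1] and extended by 0 on the left and by 1 on the right of [0, 1]. *)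
Fixpoint cantor_iter (n : nat) (x : R) : R :=
  if x < 0 then 0 else
  if 1 < x then 1 else
  if n is m.+1 then
    if x <= 1 / 3 then cantor_iter m (3 * x) / 2
    else if x < 2 / 3 then 1 / 2
    else 1 / 2 + cantor_iter m (3 * x - 2) / 2
  else x.

Definition cantor_fun (x : R) : R := limn (cantor_iter ^~ x).

Definition cantor_g (y : R) : R := (cantor_fun y + y) / 2.

Definition cantor_Phi (x : R) : R :=
  cantor_g (x - (Num.floor x)%:~R) + (Num.floor x)%:~R.

(* [cantor_Phi] is a bijection of the real line; this picks the preimage. *)
Definition cantor_Phi_inv (x : R) : R := xget 0 [set u | cantor_Phi u = x].

Definition cantor_path (x t : R) : R := cantor_Phi (t + cantor_Phi_inv x).

End cantor_function.

Section paths.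
Context {R : realType}.

Definition cadlag (f : R -> R) : Prop :=
  (forall t : R, 0 <= t -> f u @[u --> t^'+] --> f t) /\
  (forall t : R, 0 < t -> cvg (f u @[u --> t^'-])).

Definition truncation_function (chi : R -> R) : Prop :=
  [/\ measurable_fun setT chi,
      exists K : R, forall y : R, `|chi y| <= K,
      exists K : R, forall y : R, K < `|y| -> chi y = 0
    & \forall y \near (0 : R), chi y = y].

End paths.

Section semimartingales.
Context {R : realType} {d : measure_display} {Omega : measurableType d}.
Implicit Types (F : R -> set (set Omega)) (P : probability Omega R).
Implicit Types (X Y M A B C : R -> Omega -> R).

Definition filtration F : Prop :=
  [/\ forall t : R, 0 <= t -> sigma_algebra setT (F t),
      forall t : R, 0 <= t -> F t `<=` measurable
    & forall s t : R, 0 <= s -> s <= t -> F s `<=` F t].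

Definition adapted F X : Prop :=
  forall t : R, 0 <= t -> forall U : set R, measurable U -> F t (X t @^-1` U).

Definition indistinguishable P X Y : Prop :=
  {ae P, forall w, forall t : R, 0 <= t -> X t w = Y t w}.

Definition martingale P F M : Prop :=
  [/\ adapted F M,
      {ae P, forall w, cadlag (M ^~ w)},
      forall t : R, 0 <= t -> P.-integrable setT (EFin \o M t)
    & forall s t : R, 0 <= s -> s <= t -> forall E, F s E ->
        (\int[P]_(w in E) (M t w)%:E = \int[P]_(w in E) (M s w)%:E)%E].

Definition stopping_time F (tau : Omega -> \bar R) : Prop :=
  (forall w, (0 <= tau w)%E) /\
  (forall t : R, 0 <= t -> F t [set w | (tau w <= t%:E)%E]).

Definition stopped M (tau : Omega -> \bar R) : R -> Omega -> R :=
  fun t w => M (fine (mine t%:E (tau w))) w.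

Definition localizing P F (tau : nat -> Omega -> \bar R) : Prop :=
  (forall n, stopping_time F (tau n)) /\
  {ae P, forall w, (forall n, (tau n w <= tau n.+1 w)%E) /\
                   tau n w @[n --> \oo] --> +oo%E}.

Definition local_martingale P F M : Prop :=
  [/\ adapted F M,
      {ae P, forall w, cadlag (M ^~ w)}
    & exists tau, localizing P F tau /\
        forall n, martingale P F (stopped M (tau n))].

Definition continuous_paths P M : Prop :=
  {ae P, forall w, {within `[0, +oo[, continuous (M ^~ w)}}.

Definition null_at_0 P M : Prop := {ae P, forall w, M 0 w = 0}.

(* M is orthogonal to every continuous local martingale. *)
Definition purely_discontinuous P F M : Prop :=
  [/\ local_martingale P F M, null_at_0 P M
    & forall N, local_martingale P F N -> continuous_paths P N ->
        exists L, local_martingale P F L /\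
          indistinguishable P L (fun t w => M t w * N t w)].

Definition finite_variation P F A : Prop :=
  [/\ adapted F A,
      {ae P, forall w, cadlag (A ^~ w)},
      null_at_0 P A
    & {ae P, forall w, forall t : R, 0 <= t -> bounded_variation 0 t (A ^~ w)}].

Definition semimartingale P F X : Prop :=
  [/\ adapted F X,
      {ae P, forall w, cadlag (X ^~ w)}
    & exists M A, [/\ local_martingale P F M, null_at_0 P M,
        finite_variation P F A
      & indistinguishable P X (fun t w => X 0 w + M t w + A t w)]].

(* The predictable sigma-algebra on Omega x [0, +oo[. *)
Definition predictable_rectangles F : set (set (Omega * R)) :=
  [set S | (exists2 E, F 0 E & S = E `*` [set 0]) \/
           (exists (s t : R) E, [/\ 0 <= s, s < t, F s E & S = E `*` `]s, t]])].

Definition predictable_sets F : set (set (Omega * R)) :=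
  <<s setT `*` `[0, +oo[, predictable_rectangles F >>.

Definition predictable d' (T : measurableType d') F (H : R -> Omega -> T)
    : Prop :=
  forall U, measurable U ->
    predictable_sets F [set z | 0 <= z.2 /\ U (H z.2 z.1)].

(* The product on Omega x [0, +oo[ x R of the predictable sigma-algebra and of
   the Borel sigma-algebra. *)
Definition predictable_sets2 F : set (set (Omega * R * R)) :=
  <<s (setT `*` `[0, +oo[) `*` setT,
      [set S | exists E U, [/\ predictable_sets F E,
                 measurable (U : set R) & S = E `*` U]] >>.

Definition predictable_integrand F (W : Omega -> R -> R -> \bar R) : Prop :=
  (forall w s y, (0 <= W w s y)%E) /\
  forall U : set (\bar R), measurable U ->
    predictable_sets2 F
      [set z | 0 <= z.1.2 /\ U (W z.1.1 z.1.2 z.2)].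

Definition jump X (t : R) (w : Omega) : R :=
  X t w - lim (X u w @[u --> t^'-]).

(* The process X without its big jumps; the sum has finite support for every
   cadlag path. *)
Definition remove_big_jumps (chi : R -> R) X : R -> Omega -> R :=
  fun t w => X t w - \sum_(s \in `]0, t]) (jump X s w - chi (jump X s w)).

(* B is the predictable finite variation part of the canonical decomposition
   of the special semimartingale [remove_big_jumps chi X]. *)
Definition first_characteristic chi P F X B : Prop :=
  [/\ finite_variation P F B, predictable F B
    & exists M, [/\ local_martingale P F M, null_at_0 P M
      & indistinguishable P (remove_big_jumps chi X)
          (fun t w => X 0 w + M t w + B t w)]].

(* Xc is the continuous martingale part of X. *)
Definition continuous_martingale_part P F X Xc : Prop :=
  [/\ local_martingale P F Xc, null_at_0 P Xc, continuous_paths P Xc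
    & exists Md A, [/\ purely_discontinuous P F Md, finite_variation P F A
      & indistinguishable P X
          (fun t w => X 0 w + Xc t w + Md t w + A t w)]].

(* C is the predictable quadratic variation of the continuous martingale
   part of X. *)
Definition second_characteristic P F X C : Prop :=
  exists Xc, [/\ continuous_martingale_part P F X Xc,
    finite_variation P F C, predictable F C
  & exists L, local_martingale P F L /\
      indistinguishable P L (fun t w => Xc t w ^+ 2 - C t w)].

(* nu is the compensator of the random measure which puts a unit mass at each
   point (s, jump X s w) with s > 0 and a non-zero jump.  Only the restriction
   of nu w to [0, +oo[ x R matters. *)
Definition third_characteristic P F X
    (nu : Omega -> {measure set (R * R) -> \bar R}) : Prop :=
  forall W, predictable_integrand F W ->
    predictable F
      (fun t w => \int[nu w]_(z in `[0%R, t] `*` setT) W w z.1 z.2)%E /\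
    (\int[P]_w (\esum_(s in [set s : R | (0 < s)%R /\ jump X s w <> 0%R])
                  W w s (jump X s w)) =
     \int[P]_w (\int[nu w]_(z in `[0%R, +oo[ `*` setT) W w z.1 z.2))%E.

Definition characteristics chi P F X B C nu : Prop :=
  [/\ first_characteristic chi P F X B, second_characteristic P F X C
    & third_characteristic P F X nu].

Definition markov_process F (P : R -> probability Omega R) X : Prop :=
  [/\ adapted F X,
      forall x, {ae P x, forall w, X 0 w = x},
      forall (t : R) (U : set R), 0 <= t -> measurable U ->
        measurable_fun setT (fun y => P y (X t @^-1` U))
    & forall (x s t : R) E (U : set R), 0 <= s -> 0 <= t -> F s E -> measurable U ->
        (P x (E `&` X (s + t)%R @^-1` U) =
         \int[P x]_(w in E) P (X s w) (X t @^-1` U))%E].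

(* [(P, X)] is an Ito process relative to the truncation function chi.  A
   kernel on R x B(R \ {0}) is encoded as a kernel on R without mass at 0. *)
Definition ito_process chi F (P : R -> probability Omega R) X : Prop :=
  [/\ markov_process F P X,
      forall x, semimartingale (P x) F X
    & exists (l Q : R -> R) (N : R.-ker R ~> R),
      [/\ measurable_fun setT l,
          measurable_fun setT Q,
          forall x, 0 <= Q x,
          forall x, N x [set 0] = 0%E
        & forall x, exists B C nu,
          [/\ characteristics chi (P x) F X B C nu,
              {ae P x, forall w, forall t : R, 0 <= t ->
                lebesgue_measure.-integrable `[0, t]
                  (fun s => (l (X s w))%:E) /\
                B t w = \int[lebesgue_measure]_(s in `[0, t]) l (X s w)},
              {ae P x, forall w, forall t : R, 0 <= t ->
                lebesgue_measure.-integrable `[0, t]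
                  (fun s => (Q (X s w))%:E) /\
                C t w = \int[lebesgue_measure]_(s in `[0, t]) Q (X s w)}
            & {ae P x, forall w, forall S : set (R * R), measurable S ->
                nu w (S `&` (`[0, +oo[ `*` [set~ 0])) =
                (\int[lebesgue_measure]_(s in `[0%R, +oo[)
                   N (X s w) (xsection S s))%E}]]].

(* Under each P x, the process X is the deterministic Cantor path from x. *)
Definition cantor_process (P : R -> probability Omega R) X : Prop :=
  forall x, {ae P x, forall w, forall t : R, 0 <= t -> X t w = cantor_path x t}.

End semimartingales.

(* A realization: the outcome is the starting point. *)
Lemma cantor_process_dirac (R : realType) :
  cantor_process (fun x : R => dirac x : probability R R)
    (fun t x => cantor_path x t).
Proof.
move=> x; exists (~` [set x]); split.
- by apply: measurableC; exact: measurable_set1.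
- by rewrite -[LHS]/(\d_x (~` [set x])) diracE memNset //= => /(_ erefl).
- by move=> w /= nw wx; apply: nw => t _; rewrite wx.
Qed.

(* Main.v *)
(** Started from 0, the path of the Cantor process on [[0, 1]] is the function
    [cantor_g].  If the process were an Ito process, the path would be, jumps
    being absent, the sum of a local martingale and of
    [t |-> \int_0^t l (X s) ds], so the local martingale would be deterministic
    and continuous, hence constant.  Thus [cantor_g] would be an indefinite
    Lebesgue integral.  This is absurd: the Cantor function has total increment
    1 on each of the stages of the Cantor set, whose measures tend to 0. *)
Require Import Defs.
From mathcomp Require Import all_boot all_order all_algebra.
From mathcomp Require Import all_classical all_reals all_analysis measurable_realfun.
From mathcomp Require Import ring lra zify.
Set Implicit Arguments.
Unset Strict Implicit.
Unset Printing Implicit Defensive.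
Import Order.TTheory GRing.Theory Num.Theory.
Import numFieldNormedType.Exports.
Local Open Scope classical_set_scope.
Local Open Scope ring_scope.

(** * Self-similarity and Hölder continuity of the Cantor function *)

Section cantor_function.
Context {R : realType}.
Implicit Types (x y : R) (n k : nat).

Lemma cantor_iter_le0 n x : x <= 0 -> cantor_iter n x = 0.
Proof.
elim: n x => [|n IH] x x0 /=.
  by case: ltP => // x0n; case: ltP => ?; lra.
case: ltP => // x0n; case: ltP => [|_]; first by lra.
case: (leP x (1 / 3)) => [_|x3]; first by rewrite IH ?mul0r//; lra.
by lra.
Qed.

Lemma cantor_iter_ge1 n x : 1 <= x -> cantor_iter n x = 1.
Proof.
elim: n x => [|n IH] x x1 /=.
  by case: ltP => [|_]; first lra; case: ltP => // ?; lra.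
case: ltP => [|_]; first by lra.
case: ltP => // x1n; case: (leP x (1 / 3)) => [|_]; first by lra.
case: ltP => [|_]; first by lra.
by rewrite IH; lra.
Qed.

(** The extension by 0 and 1 outside [0, 1] absorbs the case split: on each third, at least one of
    the two rescaled copies is frozen at 0 or 1. *)
Lemma cantor_iterS n x :
  cantor_iter n.+1 x = (cantor_iter n (3 * x) + cantor_iter n (3 * x - 2)) / 2.
Proof.
rewrite [LHS]/=; case: ltP => x0; first by rewrite !cantor_iter_le0; lra.
case: ltP => x1; first by rewrite !cantor_iter_ge1; lra.
case: (leP x (1 / 3)) => x3.
  by rewrite (cantor_iter_le0 n (x := 3 * x - 2)) ?addr0//; lra.
case: ltP => x23; first by rewrite cantor_iter_ge1 ?cantor_iter_le0; lra.
by rewrite (cantor_iter_ge1 n (x := 3 * x)); lra.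
Qed.

Lemma cantor_iter_itv n x : 0 <= cantor_iter n x <= 1.
Proof.
elim: n x => [|n IH] x; first by rewrite /=; case: ltP => ?; case: ltP => ?; lra.
by rewrite cantor_iterS; have := IH (3 * x); have := IH (3 * x - 2); lra.
Qed.

(* At most one of the two self-similar copies moves, so each step halves the
   distance. *)
Lemma cantor_iter_dist n k x :
  `|cantor_iter (n + k) x - cantor_iter n x| <= 2^-1 ^+ n.
Proof.
elim: n x => [|n IH] x.
  rewrite expr0; have := cantor_iter_itv (0 + k) x.
  by have := cantor_iter_itv 0 x; rewrite ler_norml; lra.
rewrite addSn !cantor_iterS exprS.
have [x1|x1] := leP 1 (3 * x).
  rewrite !(@cantor_iter_ge1 _ (3 * x))//.
  by have := IH (3 * x - 2); rewrite !ler_norml; lra.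
rewrite !(@cantor_iter_le0 _ (3 * x - 2)); try lra.
by have := IH (3 * x); rewrite !ler_norml; lra.
Qed.

Lemma cvg_half_expn : (2^-1 : R) ^+ n @[n --> \oo] --> 0.
Proof. by apply: cvg_expr; rewrite ger0_norm ?invr_ge0// invf_lt1// ltr1n. Qed.

Lemma cvg_cantor_iter x : cantor_iter ^~ x @ \oo --> cantor_fun x.
Proof.
apply/cauchy_cvgP/cauchy_exP => e e0.
have [n _ /(_ n (leqnn n))] := (@cvgr0Pnorm_lt _ _ _ _ _ _).1 cvg_half_expn _ e0.
rewrite /= ger0_norm ?exprn_ge0 ?invr_ge0// => ne.
exists (cantor_iter n x); exists n => // m /= nm.
rewrite /ball /= distrC; apply: le_lt_trans ne.
by rewrite -(subnKC nm); exact: cantor_iter_dist.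
Qed.

Lemma cantor_fun_le0 x : x <= 0 -> cantor_fun x = 0.
Proof.
move=> x0; apply: cvg_lim => //.
by under eq_fun do rewrite cantor_iter_le0//; exact: cvg_cst.
Qed.

Lemma cantor_fun_ge1 x : 1 <= x -> cantor_fun x = 1.
Proof.
move=> x1; apply: cvg_lim => //.
by under eq_fun do rewrite cantor_iter_ge1//; exact: cvg_cst.
Qed.

Lemma cantor_fun_itv x : 0 <= cantor_fun x <= 1.
Proof.
have c := cvgP _ (@cvg_cantor_iter x).
by apply/andP; split; [apply: limr_ge|apply: limr_le] => //;
  apply: nearW => n; case/andP: (cantor_iter_itv n x).
Qed.

Lemma cantor_fun_self_similar x :
  cantor_fun x = (cantor_fun (3 * x) + cantor_fun (3 * x - 2)) / 2.
Proof.
apply: cvg_lim => //; rewrite -(cvg_shiftS _).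
under eq_fun do rewrite cantor_iterS.
by apply: cvgMr_tmp; apply: cvgD; exact: cvg_cantor_iter.
Qed.

(** Hölder continuity of exponent log 2 / log 3 at triadic scales: each magnification by 3 doubles
    the increment. *)
Lemma cantor_fun_holder n x y :
  `|x - y| <= 3^-1 ^+ n -> `|cantor_fun x - cantor_fun y| <= 2^-1 ^+ n.
Proof.
elim: n x y => [|n IH] x y.
  move=> _; have := cantor_fun_itv x; have := cantor_fun_itv y.
  by rewrite expr0 ler_norml; lra.
rewrite !exprS => xy.
have e1 : (3^-1 : R) ^+ n <= 1.
  by rewrite exprn_ile1 ?invr_ge0// invf_le1// ler1n.
have xy1 : `|3 * x - 3 * y| <= 3^-1 ^+ n by move: xy; rewrite !ler_norml; lra.
have xy2 : `|(3 * x - 2) - (3 * y - 2)| <= 3^-1 ^+ n.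
  by move: xy; rewrite !ler_norml; lra.
move: (IH _ _ xy1) (IH _ _ xy2).
rewrite (cantor_fun_self_similar x) (cantor_fun_self_similar y).
(* Points at distance at most 1/3 cannot lie one below 1/3 and the other above 2/3, so one of the
   two copies takes the same value at both. *)
have [[x1 y1]|[x2 y2]] : (1 <= 3 * x /\ 1 <= 3 * y) \/
    (3 * x - 2 <= 0 /\ 3 * y - 2 <= 0).
  move: xy; rewrite ler_norml.
  have [] := leP 1 (3 * x); have [] := leP 1 (3 * y); [left|right|right|right];
    split; lra.
- by rewrite !(@cantor_fun_ge1 (3 * _))// => _; rewrite !ler_norml; lra.
- by rewrite !(@cantor_fun_le0 (3 * _ - 2))// !ler_norml; lra.
Qed.

Lemma cantor_fun_unif_continuous (e : R) : 0 < e -> exists2 d : R, 0 < d &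
  forall x y, `|x - y| <= d -> `|cantor_fun x - cantor_fun y| <= e.
Proof.
move=> e0; have [n _ /(_ n (leqnn n))] := (@cvgr0Pnorm_lt _ _ _ _ _ _).1 cvg_half_expn _ e0.
rewrite /= ger0_norm ?exprn_ge0 ?invr_ge0// => ne.
exists (3^-1 ^+ n); first by rewrite exprn_gt0// invr_gt0.
by move=> x y /cantor_fun_holder /le_trans; apply; exact: ltW.
Qed.

Lemma cantor_fun_third x : x <= 1 -> cantor_fun (x / 3) = cantor_fun x / 2.
Proof.
move=> x1; rewrite cantor_fun_self_similar (_ : 3 * (x / 3) = x); last by field.
by rewrite (@cantor_fun_le0 (x - 2)) ?addr0//; lra.
Qed.

Lemma cantor_fun_two_thirds x : 0 <= x ->
  cantor_fun ((2 + x) / 3) = (1 + cantor_fun x) / 2.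
Proof.
move=> x0; rewrite cantor_fun_self_similar.
rewrite (_ : 3 * ((2 + x) / 3) = 2 + x); last by field.
by rewrite (@cantor_fun_ge1 (2 + x)); [congr ((_ + cantor_fun _) / _); ring|lra].
Qed.

(** * The path of the Cantor process started from 0 *)

Lemma cantor_g_unif_continuous (e : R) : 0 < e -> exists2 d : R, 0 < d &
  forall x y, `|x - y| <= d -> `|cantor_g x - cantor_g y| <= e.
Proof.
move=> e0; have [d d0 h] := cantor_fun_unif_continuous e0.
exists (Num.min d e) => [|x y]; first by rewrite lt_min d0.
rewrite le_min => /andP[/h + xye]; move: xye.
by rewrite /cantor_g !ler_norml; lra.
Qed.

Lemma cantor_g_continuous : continuous (cantor_g : R -> R).
Proof.
move=> x; apply/cvgrPdist_le => e e0.
have [d d0 h] := cantor_g_unif_continuous e0.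
by near=> y; apply: h; near: y; exact: cvgr_dist_le d0.
Unshelve. all: by end_near. Qed.

Lemma cantor_Phi_itv x : 0 <= x <= 1 -> cantor_Phi x = cantor_g x.
Proof.
move=> /andP[x0]; rewrite le_eqVlt => /predU1P[->|x1].
  (* At 1 the floor jumps to 1, and [cantor_g 0 + 1] agrees with [cantor_g 1]. *)
  rewrite /cantor_Phi floor1 subrr /cantor_g cantor_fun_le0//.
  by rewrite cantor_fun_ge1//; lra.
have -> : cantor_Phi x = cantor_g (x - 0) + 0.
  by rewrite /cantor_Phi (@floor_def _ x 0%Z)// x0.
by rewrite subr0 addr0.
Qed.

(** The default of [xget] is already 0, so it suffices that every preimage of 0 is 0. *)
Lemma cantor_Phi_inv0 : cantor_Phi_inv (0 : R) = 0.
Proof.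
rewrite /cantor_Phi_inv; case: xgetP => // u _ /=.
rewrite /cantor_Phi /cantor_g; set f := Num.floor u.
have fu : f%:~R <= u by exact: floor_le_tmp.
have uf : u < (f + 1)%:~R by exact: floorD1_gt.
rewrite intrD in uf.
have := cantor_fun_itv (u - f%:~R) => h01 E.
(* On fractional parts [cantor_g] takes values in [0, 1[, so the floor lies in ]-1, 0]. *)
have f0 : f = 0.
  have : -1%:~R < (f%:~R : R) <= 0%:~R by rewrite mulr1z mulr0z; lra.
  by rewrite -mulrNz ltr_int ler_int; lia.
by rewrite f0 mulr0z in fu E h01 *; lra.
Qed.

Lemma cantor_path0 (t : R) : 0 <= t <= 1 -> cantor_path 0 t = cantor_g t.
Proof. by move=> t01; rewrite /cantor_path cantor_Phi_inv0 addr0 cantor_Phi_itv. Qed.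

End cantor_function.

(** * Deterministic continuous local martingales *)

Section deterministic_local_martingale.
Context {R : realType} {d : measure_display} {Omega : measurableType d}.
Implicit Types (F : R -> set (set Omega)) (P : probability Omega R).
Implicit Types (tau : Omega -> \bar R) (M : R -> Omega -> R) (m : R -> R).

Definition survival P tau (t : R) : R := fine (P [set w | (t%:E < tau w)%E]).

Lemma stopping_time_gt F tau t : filtration F -> stopping_time F tau ->
  0 <= t -> F t [set w | (t%:E < tau w)%E].
Proof.
move=> [sF _ _] [_ tauF] t0; have [_ FC _] := sF t t0.
rewrite (_ : [set _ | _] = setT `\` [set w | (tau w <= t%:E)%E]).
  exact/FC/tauF.
apply/seteqP; split=> w /=; last by case=> _ /negP; rewrite -ltNge.
by move=> tw; split=> //; apply/negP; rewrite -ltNge.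
Qed.

Lemma Rintegral_setD0 P (D N : set Omega) (f : Omega -> R) :
  measurable D -> measurable N -> P N = 0%E ->
  P.-integrable D (EFin \o f) ->
  \int[P]_(w in D) f w = \int[P]_(w in D `\` N) f w.
Proof. by move=> mD mN PN0 fi; rewrite /Rintegral (negligible_integral mN). Qed.

(* The martingale property on [{tau > s}] gives
   [(m t - m s) P(tau > t) + E[m tau - m s; s < tau <= t] = 0]. *)
Lemma stopped_martingale_increment P F M tau m (s t e : R) :
  filtration F -> stopping_time F tau -> martingale P F (stopped M tau) ->
  0 <= s -> s <= t ->
  {ae P, forall w, forall u, s <= u <= t -> M u w = m u} ->
  (forall u, s <= u <= t -> `|m u - m s| <= e) ->
  `|m t - m s| * survival P tau t <= e * (survival P tau s - survival P tau t).
Proof.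
move=> fF stau [_ _ iM EM] s0 st [N [mN PN0 MN]] me.
have t0 := le_trans s0 st.
have [_ mF _] := fF.
set Es := [set w | (s%:E < tau w)%E]; set Et := [set w | (t%:E < tau w)%E].
have FEs : F s Es by exact: stopping_time_gt.
have mEs : measurable Es by exact: mF FEs.
have mEt : measurable Et by apply: (mF t t0); exact: stopping_time_gt.
have Ets : Et `<=` Es by move=> w; apply: le_lt_trans; rewrite lee_fin.
(* Outside the null set [N], the path of [M] equals [m] throughout [s, t]. *)
pose A := Es `\` N; pose B := Et `\` N.
have mA : measurable A by exact: measurableD.
have mB : measurable B by exact: measurableD.
have BA : B `<=` A by move=> w [/Ets].
have finP D : measurable D -> P D \is a fin_num by exact: fin_num_measure.
have PD D : measurable D -> P (D `\` N) = P D.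
  move=> mD; have PDN : P (D `&` N) = 0%E.
    by apply: (subset_measure0 _ mN _ PN0) => //; exact: measurableI.
  transitivity (P D - P (D `&` N))%E; last by rewrite PDN sube0.
  by apply: measureD => //; rewrite ltey_eq finP.
pose Y w := stopped M tau t w - m s.
have iS u D : 0 <= u -> measurable D ->
    P.-integrable D (EFin \o stopped M tau u).
  by move=> u0 mD; apply: integrableS (iM u u0).
have ic D k : measurable D -> P.-integrable D (EFin \o cst k).
  exact: finite_measure_integrable_cst.
have iY D : measurable D -> P.-integrable D (EFin \o Y).
  by move=> mD; exact: integrableB (iS t D t0 mD) (ic D (m s) mD).
have good w u : ~ N w -> s <= u <= t -> M u w = m u.
  by move=> Nw; apply: contrapT => h; apply/Nw/MN => /= /(_ u).
have Ys w : A w -> stopped M tau s w = m s.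
  case=> sw Nw; rewrite /stopped min_l ?(ltW sw)//=.
  by apply: good => //; rewrite lexx.
have Yt w : B w -> Y w = m t - m s.
  by case=> tw Nw; rewrite /Y /stopped min_l ?(ltW tw)//= good// st lexx.
(* Here [tau] is finite and lies in ]s, t], so the process stopped at [tau] has the value of [m] at
   [tau]. *)
have YD w : (A `\` B) w -> `|Y w| <= e.
  move=> [[sw Nw] Bw]; have tw : (tau w <= t%:E)%E.
    by rewrite leNgt; apply/negP => tw; apply: Bw.
  rewrite /Y /stopped min_r//; move: sw tw; rewrite /Es /=.
  by case: (tau w) => //= r; rewrite lte_fin lee_fin => sr rt;
    have srt : s <= r <= t; rewrite ?(ltW sr)// good//; exact: me.
(* Since [Es] belongs to [F s], the martingale property replaces time [t] by time [s], where the
   stopped process equals [m s] on [A]. *)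
have IA : \int[P]_(w in A) Y w = 0.
  rewrite RintegralB//; [|exact: iS|exact: ic].
  rewrite -Rintegral_setD0//; last exact: iS.
  rewrite {1}/Rintegral (EM s t)// -/(Rintegral _ _ _).
  rewrite (Rintegral_setD0 mEs mN)//; last exact: iS.
  rewrite (@eq_Rintegral _ _ _ _ _ (cst (m s))) ?subrr// => w /set_mem.
  exact: Ys.
have AB : A = B `|` (A `\` B) by rewrite setDUK.
have mAB : measurable (A `\` B) by exact: measurableD.
move: IA; rewrite AB Rintegral_setU//; last 2 first.
- by rewrite -AB; exact: iY.
- by apply/disj_setPS => w [? []].
rewrite (@eq_Rintegral _ _ _ _ _ (cst (m t - m s))); last first.
  by move=> w /set_mem; exact: Yt.
rewrite Rintegral_cst// => /eqP; rewrite addr_eq0 => /eqP IB.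
have pB : 0 <= fine (P B) by exact: fine_ge0.
rewrite /survival -(PD _ mEs) -(PD _ mEt) -/A -/B -{1}(ger0_norm pB) -normrM IB normrN.
apply: le_trans (le_normr_Rintegral mAB (iY _ mAB)) _.
have -> : fine (P A) - fine (P B) = fine (P (A `\` B)).
  rewrite -fineB ?finP//; congr fine; rewrite -[in LHS](setIidr BA).
  by apply/esym/measureD => //; rewrite ltey_eq finP.
rewrite -Rintegral_cst//; apply: le_Rintegral => //.
- exact: integrable_abse (iY _ mAB).
- exact: ic.
Qed.

(** The indicators of [tau n > t] tend to 1 almost surely, hence so do their means by dominated
    convergence; 1/2 is a convenient bound below 1. *)
Lemma localizing_survival P F (tau : nat -> Omega -> \bar R) (t : R) :
  filtration F -> localizing P F tau -> 0 <= t ->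
  exists n, 2^-1 <= survival P (tau n) t.
Proof.
move=> fF [stau [N [mN PN0 tauN]]] t0.
have mE n : measurable [set w | (t%:E < tau n w)%E].
  by have [_ mF _] := fF; apply: (mF t t0); exact: stopping_time_gt.
pose f n w : \bar R := (\1_[set w | (t%:E < tau n w)%E] w)%:E.
have mf n : measurable_fun setT (f n).
  by apply/measurable_EFinP; exact: measurable_indic.
have [] := @dominated_convergence _ _ _ P setT measurableT f (cst 1%E) (cst 1%E) mf.
- exact: measurable_cst.
- exists N; split=> // w /= nw; apply: tauN => -[_ /= taul]; apply: nw => _.
  apply: cvg_near_cst; move/cvgeyPgt : taul => /(_ t).
  apply: filterS => n tn; rewrite /f indicE mem_set//.
- exact: finite_measure_integrable_cst.
- apply: aeW => w n _; rewrite /f indicE /= lee_fin.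
  by case: (_ \in _); rewrite ?normr1 ?normr0.
move=> _ _ cv.
have {}cv : P [set w | (t%:E < tau n w)%E] @[n --> \oo] --> 1%E.
  have P1 : (\int[P]_(w in setT) cst 1%E w)%E = 1%E.
    by rewrite integral_cst// mul1e; exact: probability_setT.
  rewrite -{}P1; apply: cvg_trans cv; apply: near_eq_cvg; near=> n.
  by rewrite /f /mk_sequence integral_indic// setIT.
have lt1 : 2^-1 < 1 :> R by rewrite invf_lt1 ?ltr1n.
have [n _ /(_ n (leqnn n)) /=] := cvgr_ge _ (fine_cvg cv) _ lt1.
by exists n.
Unshelve. all: by end_near. Qed.

(* A continuous deterministic local martingale is constant: its increments over
   a partition are at most twice the modulus of continuity times those of a
   survival function, whose total mass is at most one. *)
Lemma local_martingale_deterministic P F M m (T : R) :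
  filtration F -> local_martingale P F M ->
  {ae P, forall w, forall u, 0 <= u <= T -> M u w = m u} ->
  (forall e, 0 < e -> exists2 h : R, 0 < h &
     forall u v, 0 <= u -> u <= v -> v <= T -> v - u <= h -> `|m v - m u| <= e) ->
  forall t, 0 <= t <= T -> m t = m 0.
Proof.
move=> fF [_ _ [tau [loc mart]]] Mm cm t /andP[t0 tT].
have [n Sn] := localizing_survival fF loc t0.
have stau := loc.1 n.
set S := survival P (tau n) in Sn.
have S01 u : 0 <= u -> 0 <= S u <= 1.
  move=> u0; rewrite /S /survival fine_ge0//= -lee_fin fineK ?fin_num_measure//.
    apply: probability_le1; have [_ mF _] := fF; apply: (mF u u0).
    exact: stopping_time_gt.
  by have [_ mF _] := fF; apply: (mF u u0); exact: stopping_time_gt.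
have Sle u v : 0 <= u -> u <= v -> S v <= S u.
  move=> u0 uv; have v0 := le_trans u0 uv; have [_ mF _] := fF.
  have mS x : 0 <= x -> measurable [set w | (x%:E < tau n w)%E].
    by move=> x0; apply: (mF x x0); exact: stopping_time_gt.
  rewrite /S /survival fine_le ?fin_num_measure//; try exact: mS.
  apply: le_measure; rewrite ?inE; try exact: mS.
  by move=> w; apply: le_lt_trans; rewrite lee_fin.
suff small e : 0 < e -> `|m t - m 0| <= 2 * e.
  apply/eqP; rewrite -subr_eq0 -normr_le0; apply/ler_addgt0Pr => e e0.
  by rewrite add0r (le_trans (small (e / 2) _))//; lra.
move=> e0; have [h h0 mh] := cm e e0.
(* The successor makes [k] positive and larger than [t / h], so the mesh is at most [h]. *)
pose k := (Num.truncn (t / h)).+1; pose p i : R := t * i%:R / k%:R.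
have k0 : 0 < k%:R :> R by rewrite ltr0n.
have pS i : p i.+1 = p i + t / k%:R by rewrite /p -natr1 mulrDr mulr1 mulrDl.
have tk : t / k%:R <= h.
  rewrite ler_pdivrMr// mulrC -ler_pdivrMr//; apply/ltW.
  by rewrite /k truncnS_gt.
have tk0 : 0 <= t / k%:R by rewrite divr_ge0.
have p0 i : 0 <= p i by rewrite /p -mulrA mulr_ge0// divr_ge0.
have pt i : (i <= k)%N -> p i <= t.
  by move=> ik; rewrite /p -mulrA ler_piMr// ler_pdivrMr// mul1r ler_nat.
have pk : p k = t by rewrite /p mulfK// gt_eqF.
(* The bound telescopes along the partition, and [S] drops by at most 1 in total. *)
suff H i : (i <= k)%N -> `|m (p i) - m 0| <= 2 * e * (S 0 - S (p i)).
  have := H k (leqnn k); rewrite pk => /le_trans; apply.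
  have := S01 0 (lexx _); have := S01 t t0.
  by move=> ? ?; apply: ler_piMr; lra.
elim: i => [_|i IH ik].
  by rewrite /p mulr0 mul0r !subrr normr0 mulr0.
have pii : p i <= p i.+1 by rewrite pS lerDl.
have inc : `|m (p i.+1) - m (p i)| * S (p i.+1) <= e * (S (p i) - S (p i.+1)).
  apply: (stopped_martingale_increment fF stau (mart n) (p0 i) pii).
  - case: Mm => N [mN N0 MN]; exists N; split=> // w /= nw; apply: MN => /= h'.
    apply: nw => u /andP[u1 u2]; apply: h'; rewrite (le_trans (p0 i))//=.
    by rewrite (le_trans u2)// (le_trans (pt _ ik)).
  - move=> u /andP[u1 u2]; apply: mh => //.
      by rewrite (le_trans u2)// (le_trans (pt _ ik)).
    by move: u2; rewrite pS; lra.
(* As [S] is nonincreasing, its bound at [t] holds at every partition point; dividing by it yields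
   the factor 2. *)
have St : 2^-1 <= S (p i.+1).
  by rewrite (le_trans Sn)// Sle// pt.
have a2 : `|m (p i.+1) - m (p i)| <= 2 * e * (S (p i) - S (p i.+1)).
  have : 0 <= `|m (p i.+1) - m (p i)| * (S (p i.+1) - 2^-1).
    by rewrite mulr_ge0 ?subr_ge0.
  move: inc; lra.
have := IH (ltnW ik).
have := ler_normD (m (p i.+1) - m (p i)) (m (p i) - m 0).
rewrite addrA subrK; move: a2; lra.
Qed.

End deterministic_local_martingale.

(** * Absolute continuity of the integral, and its failure for [cantor_g] *)

Lemma Rintegral_absolutely_continuous (d : measure_display)
    (T : measurableType d) (R : realType) (mu : {measure set T -> \bar R})
    (D : set T) (f : T -> R) (e : R) :
  measurable D -> mu.-integrable D (EFin \o f) -> 0 < e ->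
  exists2 h : R, 0 < h & forall A, measurable A -> A `<=` D ->
    (mu A <= h%:E)%E -> `|\int[mu]_(x in A) f x| <= e.
Proof.
move=> mD fi e0.
have fDi : mu.-integrable setT (EFin \o (f \_ D)).
  by rewrite -restrict_EFin; exact: (iffLR (integrable_mkcond _ mD) fi).
have [h [h0 hA]] := integral_normr_continuous fDi e0.
(* Halving turns the non-strict bound on the measure into a strict one. *)
exists (h / 2) => [|A mA AD muA]; first by rewrite divr_gt0.
apply: le_trans (le_normr_Rintegral mA (integrableS mD mA AD fi)) _.
have {}hA : \int[mu]_(x in A) `|(f \_ D) x| < e.
  by apply: hA => //; apply: le_lt_trans muA _; rewrite lte_fin; lra.
apply/ltW; congr (_ < _): hA; apply: eq_Rintegral => x /set_mem Ax.
by rewrite patchE mem_set//; exact: AD.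
Qed.

Section absolute_continuity.
Context {R : realType}.
Notation mu := (@lebesgue_measure R).
Implicit Type f : R -> R.

(** [F] is left general to cover both [cantor_g] and the indefinite integral itself. *)
Lemma Rintegral_itv_increment f (F : R -> R) (a b : R) :
  mu.-integrable `[0, 1] (EFin \o f) ->
  (forall t, 0 <= t <= 1 -> \int[mu]_(x in `[0, t]) f x = F t) ->
  0 <= a -> a <= b -> b <= 1 -> \int[mu]_(x in `]a, b]) f x = F b - F a.
Proof.
move=> fi fF a0 ab b1.
rewrite -!fF; [|by rewrite a0 (le_trans ab)|by rewrite (le_trans a0)].
rewrite (@Rintegral_itvB _ f (BLeft 0) (BRight b) a) ?bnd_simp//.
by apply: integrableS fi => //; apply: subset_itvl; rewrite bnd_simp.
Qed.

(* The set built in n steps is the n-th stage of the Cantor set inside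
   [`]a, a + r]]: it supports the whole increment of the Cantor function. *)
Lemma cantor_fun_increment_set f (n : nat) (a r c : R) :
  mu.-integrable `[0, 1] (EFin \o f) ->
  (forall t, 0 <= t <= 1 -> \int[mu]_(x in `[0, t]) f x = cantor_g t) ->
  0 <= a -> 0 < r -> a + r <= 1 ->
  (forall s, 0 <= s <= 1 ->
     cantor_fun (a + r * s) = cantor_fun a + c * cantor_fun s) ->
  exists A, [/\ measurable A, A `<=` `]a, a + r],
    (mu A <= ((2 / 3) ^+ n * r)%:E)%E & c / 2 <= \int[mu]_(x in A) f x].
Proof.
move=> fi fg; elim: n a r c => [|n IH] a r c a0 r0 ar1 hs.
  (* Over the whole interval [cantor_g] increases by (c + r) / 2, which exceeds c / 2. *)
  exists `]a, a + r]%classic; split=> //.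
    rewrite lebesgue_measure_itv /= lte_fin ltrDl r0 -EFinD lee_fin expr0; lra.
  rewrite (Rintegral_itv_increment fi fg)//; last lra.
  have := hs 1; rewrite mulr1 (@cantor_fun_ge1 _ 1)// ler01 lexx => /(_ isT).
  by rewrite /cantor_g => ->; lra.
have r3 : 0 < r / 3 by lra.
(* The left third carries a copy of the Cantor function with half of the increment [c]. *)
have hs1 s : 0 <= s <= 1 ->
    cantor_fun (a + r / 3 * s) = cantor_fun a + c / 2 * cantor_fun s.
  move=> s01; rewrite (_ : r / 3 * s = r * (s / 3)); last by field.
  by rewrite hs ?cantor_fun_third; lra.
(* The right third carries the other half, on top of the c / 2 already gained. *)
have hs2' s : 0 <= s <= 1 ->
    cantor_fun (a + 2 / 3 * r + r / 3 * s) =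
      cantor_fun a + c / 2 * (1 + cantor_fun s).
  move=> s01.
  rewrite (_ : _ + r / 3 * s = a + r * ((2 + s) / 3)); last by field.
  by rewrite hs ?cantor_fun_two_thirds; lra.
have hs2 s : 0 <= s <= 1 -> cantor_fun (a + 2 / 3 * r + r / 3 * s) =
    cantor_fun (a + 2 / 3 * r) + c / 2 * cantor_fun s.
  move=> s01; rewrite hs2'//.
  have := hs2' 0; rewrite mulr0 addr0 => ->; last by rewrite lexx ler01.
  by rewrite (@cantor_fun_le0 _ 0)//; lra.
have ar1' : a + r / 3 <= 1 by lra.
have a20 : 0 <= a + 2 / 3 * r by lra.
have ar2 : a + 2 / 3 * r + r / 3 <= 1 by lra.
have [A1 [mA1 sA1 muA1 iA1]] := IH a (r / 3) (c / 2) a0 r3 ar1' hs1.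
have [A2 [mA2 sA2 muA2 iA2]] := IH _ (r / 3) (c / 2) a20 r3 ar2 hs2.
have itvs : `]a, a + r]%classic `<=` (`[0, 1]%classic : set R).
  by move=> x /=; rewrite !in_itv/= => /andP[? ?]; lra.
have sA : A1 `|` A2 `<=` `]a, a + r].
  move=> x [/sA1|/sA2] /=; rewrite !in_itv/= => /andP[? ?]; lra.
have mA : measurable (A1 `|` A2) by exact: measurableU.
exists (A1 `|` A2); split=> //.
  rewrite (le_trans (measureU2 _ _ _))// (le_trans (leeD muA1 muA2))//.
  by rewrite -EFinD lee_fin exprS; lra.
(* The middle third separates [A1] from [A2], so their contributions of at least c / 4 each add
   up. *)
rewrite Rintegral_setU//; first lra.
- by apply: integrableS fi => //; exact: subset_trans itvs.
- apply/disj_setPS => x [/sA1/= + /sA2/=].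
  by rewrite !in_itv/= => /andP[_ x1] /andP[x2 _]; exfalso; lra.
Qed.

(** Sets of measure at most (2/3)^n would carry an integral of at least 1/2, against absolute
    continuity with tolerance 1/4. *)
Lemma cantor_g_not_Rintegral f : mu.-integrable `[0, 1] (EFin \o f) ->
  ~ (forall t, 0 <= t <= 1 -> \int[mu]_(x in `[0, t]) f x = cantor_g t).
Proof.
move=> fi fg; have e0 : 0 < 4^-1 :> R by rewrite invr_gt0.
have [|h h0 hA] := Rintegral_absolutely_continuous _ fi e0.
  exact: measurable_itv.
have c23 : (2 / 3 : R) ^+ n @[n --> \oo] --> 0.
  by apply: cvg_expr; rewrite ger0_norm; lra.
have [n _ /(_ n (leqnn n))] := (@cvgr0Pnorm_lt _ _ _ _ _ _).1 c23 _ h0.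
rewrite /= ger0_norm ?exprn_ge0// => nh.
have h01 s : 0 <= s <= 1 ->
    cantor_fun (0 + 1 * s) = cantor_fun 0 + 1 * cantor_fun s :> R.
  by rewrite add0r !mul1r (@cantor_fun_le0 _ 0)// add0r.
have le01 : 0 + 1 <= 1 :> R by rewrite add0r.
have [A [mA sA muA iA]] :=
  cantor_fun_increment_set n fi fg (lexx _) ltr01 le01 h01.
have : `|\int[mu]_(x in A) f x| <= 4^-1.
  apply: hA => //.
    apply: subset_trans sA _; rewrite add0r.
    by apply: subset_itvr; rewrite bnd_simp.
  by apply: le_trans muA _; rewrite lee_fin mulr1 ltW.
by rewrite ler_norml => /andP[_]; lra.
Qed.

End absolute_continuity.

(** * Contradiction for the Cantor process *)

Lemma remove_big_jumps_continuous (R : realType) (d : measure_display)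
    (Omega : measurableType d) (chi : R -> R) (X : R -> Omega -> R) (w : Omega)
    (t : R) :
  chi 0 = 0 ->
  (forall s, 0 < s <= t -> X u w @[u --> s^'-] --> X s w) ->
  remove_big_jumps chi X t w = X t w.
Proof.
move=> chi0 Xc; rewrite /remove_big_jumps fsbig1 ?subr0// => s /=.
rewrite in_itv/= => /Xc sc; rewrite /jump.
by rewrite (cvg_lim _ sc)// subrr chi0 subrr.
Qed.

Theorem proposition4p2 (R : realType) (d : measure_display)
    (Omega : measurableType d) (F : R -> set (set Omega))
    (P : R -> probability Omega R) (X : R -> Omega -> R) (chi : R -> R) :
  filtration F -> truncation_function chi -> cantor_process P X ->
  ~ ito_process chi F P X.
Proof.
(* As [chi] is the identity near 0, [chi 0 = 0]. The process is started from 0. *)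
move=> fF [_ _ _ /nbhs_singleton chi0] cX [_ _ [l [Q [N [_ _ _ _ /(_ 0)]]]]].
move=> [B [C [nu [[[_ _ [M [lM _ XMB]]] _ _] Bl _ _]]]].
(* The drift rate along the deterministic path. *)
pose phi s := l (cantor_g s).
have Xg : {ae P 0, forall w, forall t : R, 0 <= t <= 1 -> X t w = cantor_g t}.
  move: (cX 0); apply: filterS => w Xw t t01.
  by case/andP: (t01) => t0 _; rewrite Xw// cantor_path0.
have int_eq w t : (forall t : R, 0 <= t <= 1 -> X t w = cantor_g t) ->
    0 <= t <= 1 -> {in `[0, t]%classic, forall s, l (X s w) = phi s}.
  move=> Xw /andP[t0 t1] s /set_mem; rewrite /= in_itv/= => /andP[s0 st].
  by rewrite Xw// s0 (le_trans st).
have P0 : ProperFilter (almost_everywhere (P 0)).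
  apply/ae_properfilter_algebraOfSetsType/(lt_le_trans lte01).
  by rewrite le_eqVlt; apply/orP; left; apply/eqP/esym/probability_setT.
(* Integrability of [phi] does not involve the outcome, so it is read off a single good one, which
   exists because [P 0] has mass 1. *)
have phii : lebesgue_measure.-integrable `[0, 1] (EFin \o phi).
  have [w [Xw /(_ 1 ler01)[li _]]] := filter_ex (filterI Xg Bl).
  apply: eq_integrable li => // s s01.
  by rewrite /= (int_eq _ _ Xw _ _ s01)// ler01 lexx.
(* The deterministic value of [X - X 0 - B] on [0, 1], hence of the local martingale [M]. *)
pose m t := cantor_g t - \int[lebesgue_measure]_(s in `[0, t]) phi s.
have g0 : cantor_g 0 = 0 :> R by rewrite /cantor_g cantor_fun_le0//; lra.
have Mm : {ae P 0, forall w, forall u, 0 <= u <= 1 -> M u w = m u}.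
  apply: filterS (filterI Xg (filterI Bl XMB)) => w [Xw [Bw XMw]] t t01.
  have /andP[t0 t1] := t01.
  have Bphi : B t w = \int[lebesgue_measure]_(s in `[0, t]) phi s.
    have [_ ->] := Bw t t0.
    by apply: eq_Rintegral; exact: int_eq.
  have := XMw t t0; rewrite remove_big_jumps_continuous//; last first.
    move=> s /andP[s0 st]; rewrite (Xw s) ?(ltW s0) ?(le_trans st)//.
    (* The path is known only at nonnegative times; times close to [s > 0] from the left qualify. *)
    have : cantor_g u @[u --> s^'-] --> cantor_g s.
      exact/cvg_at_left_filter/cantor_g_continuous.
    apply: cvg_trans; apply: near_eq_cvg; near=> u.
    rewrite Xw//; apply/andP; split.
      by near: u; exact: nbhs_left_ge.
    by rewrite (le_trans (ltW _) (le_trans st t1)).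
  by rewrite !Xw ?lexx ?ler01// g0 Bphi /m add0r => ->; rewrite addrK.
have m_cont e : 0 < e -> exists2 h : R, 0 < h & forall u v,
    0 <= u -> u <= v -> v <= 1 -> v - u <= h -> `|m v - m u| <= e.
  move=> e0; have e20 : 0 < e / 2 by lra.
  have [h1 h10 g_h1] := cantor_g_unif_continuous e20.
  have [|h2 h20 i_h2] := Rintegral_absolutely_continuous _ phii e20.
    exact: measurable_itv.
  exists (Num.min h1 h2) => [|u v u0 uv v1]; first by rewrite lt_min h10.
  rewrite le_min => /andP[vu1 vu2].
  have g_uv : `|cantor_g v - cantor_g u| <= e / 2.
    by apply: g_h1; rewrite ger0_norm// subr_ge0.
  have i_uv : `|\int[lebesgue_measure]_(s in `]u, v]) phi s| <= e / 2.
    apply: i_h2 => //.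
      move=> x /=; rewrite !in_itv/= => /andP[? ?]; lra.
    apply: (le_trans (y := (v - u)%:E)); last by rewrite lee_fin.
    apply: (le_trans (y := lebesgue_measure `]u, v]%classic)) => //.
    rewrite lebesgue_measure_itv /= lte_fin.
    by case: ltP => _; rewrite // lee_fin subr_ge0.
  move: i_uv; rewrite (Rintegral_itv_increment phii (fun=> fun=> erefl))//.
  by move: g_uv; rewrite /m !ler_norml; lra.
have m0 : m 0 = 0 by rewrite /m g0 set_itv1 Rintegral_set1 subrr.
(* Constancy of [m] with [m 0 = 0] says that [cantor_g] is the indefinite integral of [phi]. *)
apply: (cantor_g_not_Rintegral phii) => t t01.
have := local_martingale_deterministic fF lM Mm m_cont t01.
by rewrite m0 => /eqP; rewrite subr_eq0 => /eqP.
Unshelve. all: by end_near. Qed.
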